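(* Let $X$ be a separable topological space and let $H\colon X\times X\to\mathbb{R}$ satisfy $$H(x,z)\le H(x,y)+H(y,z),\quad x,y,z\in X.$$ Assume that $H$ is continuous at every point of $\Delta=\{(x,x):x\in X\}$ and equal to $0$ at every point of $\Delta$. Then $$H(a,b)=\sup\left\{\varphi(a)-\varphi(b):\varphi\in\mathcal{H}(H)\right\},\quad a,b\in X.$$ Conversely, for an arbitrary family $\mathcal{H}$ of functions $\varphi\colon X\to\mathbb{R}$, every mapping $H\colon X\times X\to\mathbb{R}$ defined by $$H(a,b)=\sup\left\{\varphi(a)-\varphi(b):\varphi\in\mathcal{H}\right\},\quad a,b\in X$$ (that is, whenever these suprema are all real numbers), satisfies $H(x,z)\le H(x,y)+H(y,z)$ for all $x,y,z\in X$, is equal to $0$ on $\Delta$, and $\mathcal{H}\subseteq\mathcal{H}(H)$.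
   Context: For a function $H\colon X\times X\to\mathbb{R}$, $$\mathcal{H}(H)=\left\{\varphi\colon X\to\mathbb{R}\ :\ \varphi(x)-\varphi(y)\le H(x,y)\ \text{for all } x,y\in X\right\}.$$ $X\times X$ carries the product topology. A topological space is separable if it has a countable dense subset. *)

(* Defs.v *)
From HB Require Import structures.
From mathcomp Require Export all_boot all_order all_algebra.
From mathcomp Require Export all_classical all_reals all_analysis.
Export numFieldNormedType.Exports.

Set Implicit Arguments.
Unset Strict Implicit.
Unset Printing Implicit Defensive.

Import Order.TTheory GRing.Theory Num.Theory.
Local Open Scope classical_set_scope.
Local Open Scope ring_scope.

Definition separable (X : topologicalType) : Prop :=
  exists2 D : set X, countable D & dense D.

Definition triangle_ineq (R : realType) (X : Type) (H : X * X -> R) : Prop :=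
  forall x y z : X, H (x, z) <= H (x, y) + H (y, z).

Definition dominated_by (R : realType) (X : Type) (H : X * X -> R) :
    set (X -> R) :=
  [set phi | forall x y : X, phi x - phi y <= H (x, y)].

(* The supremum is taken in the extended reals, so that an equation
   [sup_diff F a b = r%:E] also says that the family of differences is nonempty
   and bounded above; the real-valued [sup] is 0 where no supremum exists. *)
Definition sup_diff (R : realType) (X : Type) (F : set (X -> R)) (a b : X) :
    \bar R :=
  ereal_sup [set (phi a - phi b)%:E | phi in F].

(* Main.v *)
Require Import Defs.

Set Implicit Arguments.
Unset Strict Implicit.
Unset Printing Implicit Defensive.

Import Order.TTheory GRing.Theory Num.Theory.

(** If [H] satisfies the triangle inequality and vanishes on the diagonal, the
    supremum defining [H (a, b)] is attained: the section [fun x => H (x, b)] is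
    dominated by [H], since [H (x, b) <= H (x, y) + H (y, b)], and its
    difference between [a] and [b] is [H (a, b) - H (b, b) = H (a, b)]. No
    dominated function can do better, by the definition of domination.

    Conversely, when all suprema over [F] are real, [H (a, b)] is characterised
    by the inequalities [H (a, b) <= c] iff [phi a - phi b <= c] for all [phi]
    in [F] ([sup_diff_le]).  Taking [c = H (a, b)] gives [F `<=` dominated_by H],
    and telescoping [phi x - phi z] through [y] gives the triangle inequality.
    On the diagonal every difference is 0, and [F] is nonempty because the
    supremum of the empty set is [-oo]. *)

Local Open Scope classical_set_scope.
Local Open Scope ring_scope.

(** Phrasing the supremum as a Galois connection with real bounds reduces
    inequalities for [H] to inequalities for each member of [F]. *)
Lemma sup_diff_le (R : realType) (X : Type) (F : set (X -> R)) (a b : X)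
    (h c : R) : h%:E = sup_diff F a b ->
  h <= c <-> (forall phi, F phi -> phi a - phi b <= c).
Proof.
rewrite -(lee_fin h) => ->; split => [le_c phi Fphi | le_c].
  rewrite -lee_fin; apply: le_trans le_c.
  by apply: ereal_sup_ubound; exists phi.
by apply: ge_ereal_sup => _ [phi Fphi <-]; rewrite lee_fin le_c.
Qed.

Lemma sup_diff_nonempty (R : realType) (X : Type) (F : set (X -> R)) (a b : X)
    (h : R) : h%:E = sup_diff F a b -> F !=set0.
Proof.
move=> hE; apply/set0P/eqP => F0; move: hE.
by rewrite /sup_diff F0 image_set0 ereal_sup0.
Qed.

(** The analogue of the Kuratowski embedding of a metric space: distances to a
    fixed point [b] are 1-Lipschitz. *)
Lemma section_dominated (R : realType) (X : Type) (H : X * X -> R) (b : X) :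
  triangle_ineq H -> dominated_by H (fun x => H (x, b)).
Proof. by move=> triH x y; rewrite lerBlDr. Qed.

Lemma sup_diff_dominated_by (R : realType) (X : Type) (H : X * X -> R) :
  triangle_ineq H -> (forall x, H (x, x) = 0) ->
  forall a b, (H (a, b))%:E = sup_diff (dominated_by H) a b.
Proof.
move=> triH H0 a b; apply/le_anti/andP; split.
  apply: ereal_sup_ubound; exists (fun x => H (x, b)).
    exact: section_dominated.
  by rewrite H0 subr0.
by apply: ge_ereal_sup => _ [phi domphi <-]; rewrite lee_fin.
Qed.

Section SupremumOfDifferences.
Variables (R : realType) (X : Type) (F : set (X -> R)) (H : X * X -> R).
Hypothesis HE : forall a b, (H (a, b))%:E = sup_diff F a b.

Lemma sup_diff_sub_dominated : F `<=` dominated_by H.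
Proof. by move=> phi Fphi x y; apply: (sup_diff_le _ (HE x y)).1. Qed.

Lemma sup_diff_triangle : triangle_ineq H.
Proof.
move=> x y z; apply/(sup_diff_le _ (HE x z)) => phi Fphi.
by rewrite -(subrKA (phi y)) lerD// sup_diff_sub_dominated.
Qed.

Lemma sup_diff_diag x : H (x, x) = 0.
Proof.
apply/le_anti/andP; split.
  by apply/(sup_diff_le _ (HE x x)) => phi _; rewrite subrr.
have [phi Fphi] := sup_diff_nonempty (HE x x).
by rewrite -(subrr (phi x)); exact: sup_diff_sub_dominated.
Qed.

End SupremumOfDifferences.

Theorem corollary5 (R : realType) (X : topologicalType) (sepX : separable X) :
  (forall H : X * X -> R,
     triangle_ineq H ->
     (forall x : X, {for (x, x), continuous H}) ->
     (forall x : X, H (x, x) = 0) ->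
     forall a b : X, (H (a, b))%:E = sup_diff (dominated_by H) a b)
  /\
  (forall (F : set (X -> R)) (H : X * X -> R),
     (forall a b : X, (H (a, b))%:E = sup_diff F a b) ->
     [/\ triangle_ineq H,
         forall x : X, H (x, x) = 0
       & F `<=` dominated_by H]).
Proof.
split=> [H triH _ H0|F H HE]; first exact: sup_diff_dominated_by.
split; [exact: sup_diff_triangle HE | exact: sup_diff_diag HE |].
exact: sup_diff_sub_dominated.
Qed.
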